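(* Let $\Gamma$ be a finitely generated group and let $\mu$ be a finitely supported, nondegenerate probability measure on $\Gamma$. Suppose that $\Gamma$ acts by homeomorphisms on a nonempty locally compact Hausdorff space $X$, and that the action is co-compact. Then there is a nonzero, $\mu$-stationary Radon measure on $X$.
   Context: A probability measure $\mu$ on $\Gamma$ is nondegenerate if its support generates $\Gamma$ as a semigroup. The action of $\Gamma$ on $X$ is co-compact if there exists a compact $K \subseteq X$ such that $X = \bigcup_{g \in \Gamma} gK$. Radon measures are non-negative, possibly infinite, Borel measures that are finite on compact sets, with the usual regularity properties (outer regular on Borel sets, inner regular on open sets). For a measure $\lambda$ on $X$ and $g \in \Gamma$, $g\lambda$ is the measure $[g\lambda](E) = \lambda(g^{-1}E)$. The measure $\lambda$ is $\mu$-stationary if $\sum_{g \in \Gamma} \mu(g)\, g\lambda = \lambda$. *)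

(* Defs.v *)
From HB Require Import structures.
From mathcomp Require Import all_boot all_order all_algebra all_fingroup.
From mathcomp Require Import all_classical all_reals all_analysis.

Set Implicit Arguments.
Unset Strict Implicit.
Unset Printing Implicit Defensive.

Import Order.TTheory GRing.Theory Num.Theory.

Local Open Scope classical_set_scope.
Local Open Scope ring_scope.

Definition subgroup_generated (G : groupType) (S : set G) : set G :=
  smallest [set H | H 1%g /\ forall g h, H g -> H h -> H (g * h^-1)%g] S.

(* 1 is not required to belong to the semigroup. *)
Definition semigroup_generated (G : groupType) (S : set G) : set G :=
  smallest [set H | forall g h, H g -> H h -> H (g * h)%g] S.

Definition finitely_generated (G : groupType) : Prop :=
  exists2 S : set G, finite_set S & subgroup_generated S = [set: G].

(* [G] with the sigma-algebra of all its subsets, as a discrete group. *)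
Definition discrete_group (G : groupType) : Type := G.

Section discrete_group.
Variable G : groupType.

HB.instance Definition _ := Choice.on (discrete_group G).
HB.instance Definition _ := isPointed.Build (discrete_group G) (1%g : G).
HB.instance Definition _ := @isMeasurable.Build default_measure_display
  (discrete_group G) discrete_measurable discrete_measurable0
  discrete_measurableC discrete_measurableU.

End discrete_group.

Definition supp (G : groupType) (R : realType)
    (mu : probability (discrete_group G) R) : set G :=
  [set g | mu [set g] != 0%E].

Definition finitely_supported (G : groupType) (R : realType)
    (mu : probability (discrete_group G) R) : Prop :=
  finite_set (supp mu).

Definition nondegenerate_measure (G : groupType) (R : realType)
    (mu : probability (discrete_group G) R) : Prop :=
  semigroup_generated (supp mu) = [set: G].

Definition group_action (G : groupType) (X : Type) (act : G -> X -> X) : Prop :=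
  (forall x, act 1%g x = x) /\
  (forall g h x, act (g * h)%g x = act g (act h x)).

Definition homeomorphism (X Y : topologicalType) (f : X -> Y) : Prop :=
  exists f' : Y -> X,
    [/\ cancel f f', cancel f' f, continuous f & continuous f'].

Definition acts_by_homeomorphisms (G : groupType) (X : topologicalType)
    (act : G -> X -> X) : Prop :=
  group_action act /\ forall g, homeomorphism (act g).

Definition cocompact (G : groupType) (X : topologicalType)
    (act : G -> X -> X) : Prop :=
  exists2 K : set X, compact K & [set: X] = \bigcup_(g in [set: G]) (act g @` K).

Notation borel X := (g_sigma_algebraType (@open X)).

Definition radon (X : ptopologicalType) (R : realType)
    (lambda : {measure set (borel X) -> \bar R}) : Prop :=
  [/\ forall K : set X, compact K -> (lambda K < +oo)%E,
      forall E : set (borel X), measurable E ->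
        lambda E = ereal_inf [set lambda U | U in [set U : set X |
          open U /\ E `<=` U]]
    & forall U : set X, open U ->
        lambda U = ereal_sup [set lambda K | K in [set K : set X |
          compact K /\ K `<=` U]]].

Definition translate (G : groupType) (X : ptopologicalType) (R : realType)
    (act : G -> X -> X) (g : G) (lambda : set (borel X) -> \bar R) :
    set (borel X) -> \bar R :=
  fun E => lambda (act g^-1%g @` E).

Definition stationary (G : groupType) (X : ptopologicalType) (R : realType)
    (act : G -> X -> X) (mu : probability (discrete_group G) R)
    (lambda : {measure set (borel X) -> \bar R}) : Prop :=
  forall E : set (borel X), measurable E ->
    (\esum_(g in [set: G]) (mu [set g] * translate act g lambda E))%E =
    lambda E.

(* Values of [lambda] off the Borel sets are irrelevant, so this is not
   [lambda <> mzero]. *)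
Definition nonzero_measure (X : ptopologicalType) (R : realType)
    (lambda : {measure set (borel X) -> \bar R}) : Prop :=
  exists2 E : set (borel X), measurable E & lambda E != 0%E.

(* Main.v *)
(* Write [P f x] for the sum of [mu g * f (g x)].  A positive linear functional
   [L] on the compactly supported functions with [L (P f) = L f] and
   [L phi = 1], for some [phi >= 0] equal to [1] on a compact set meeting every
   orbit, yields the measure by Riesz representation.  By the theorem on
   positive functionals on a space with an order unit, [L] exists unless
   [P f - f >= phi] for some compactly supported [f].  But such an [f] attains
   its maximum over the whole space, is then constant on the orbit of a maximum
   point by nondegeneracy, and so [phi] vanishes on that orbit, which is
   impossible. *)

Require Import Defs.
From HB Require Import structures.
From mathcomp Require Import all_boot all_order all_algebra all_fingroup.
From mathcomp Require Import all_classical all_reals all_analysis.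
From mathcomp Require Import lra.

Set Implicit Arguments.
Unset Strict Implicit.
Unset Printing Implicit Defensive.

Import Order.TTheory GRing.Theory Num.Theory.
Import numFieldNormedType.Exports.
Local Open Scope classical_set_scope.
Local Open Scope ring_scope.

(** * Positive functionals and order units *)

Section cone_functional.
Context (R : realType) (V : lmodType R).

Definition convex_cone (C : set V) :=
  (forall u v, C u -> C v -> C (u + v)) /\
  (forall a u, 0 < a -> C u -> C (a *: u)).

(** Zorn's lemma. The last clause is maximality in usable form: the cone obtained by adjoining [h]
    to [C] must contain [- e]. *)
Lemma maximal_cone (C0 : set V) (e : V) :
    convex_cone C0 -> C0 0 -> ~ C0 (- e) ->
  exists2 C, [/\ convex_cone C, C0 `<=` C & ~ C (- e)] &
    forall h, ~ C h -> exists2 c, C c & exists2 a, 0 < a & - e = c + a *: h.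
Proof.
move=> [C0D C0Z] C00 C0e.
(* The cone condition is imposed on the union of [C0] and [C], so that the empty union of the empty
   chain also satisfies [P]. *)
pose P (C : set V) := [/\ convex_cone (C0 `|` C) & ~ C (- e)].
have [F FP Ftot|A [[cA Ae] Amax]] := @Zorn_bigcup V P.
  split; last by move=> [C FC]; have [_] := FP _ FC.
  split=> [u v|a u a0].
    move=> [u0|[A FA Au]] [v0|[B FB Bv]]; first by left; exact: C0D.
    - have [[BD _] _] := FP _ FB.
      by have [|] := BD u v (or_introl u0) (or_intror Bv); [left|right; exists B].
    - have [[AD _] _] := FP _ FA.
      by have [|] := AD u v (or_intror Au) (or_introl v0); [left|right; exists A].
    have [AB|BA] := Ftot _ _ FA FB.
      have [[BD _] _] := FP _ FB.
      have [|] := BD u v (or_intror (AB _ Au)) (or_intror Bv); first by left.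
      by right; exists B.
    have [[AD _] _] := FP _ FA.
    have [|] := AD u v (or_intror Au) (or_intror (BA _ Bv)); first by left.
    by right; exists A.
  move=> [u0|[A FA Au]]; first by left; exact: C0Z.
  have [[_ AZ] _] := FP _ FA.
  by have [|] := AZ a u a0 (or_intror Au); [left|right; exists A].
have C0A : C0 `<=` A.
  move=> u u0; apply: contrapT => Au.
  apply: (Amax (C0 `|` A)).
    by split; [move=> v; right|move=> /(_ u (or_introl u0))].
  by split; [rewrite setUA setUid|case].
have {cA} cA : convex_cone A by rewrite -(setUidr C0A).
have [AD AZ] := cA.
exists A => // h Ah; apply: contrapT => nh.
pose B := A `|` [set u | exists2 c, A c & exists2 a, 0 < a & u = c + a *: h].
apply: (Amax B).
  split; first by move=> v; left.
  move=> /(_ h); apply: contra_not Ah; apply.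
  by right; exists 0; [exact: C0A|exists 1 => //; rewrite scale1r add0r].
split; last first.
  by move=> [//|[c Ac [a a0 eE]]]; apply: nh; exists c => //; exists a.
have -> : C0 `|` B = B by rewrite /B setUA (setUidr C0A).
split=> [u v|a u a0].
  move=> [Au|[c Ac [a a0 ->]]] [Av|[d Ad [b b0 ->]]].
  - by left; exact: AD.
  - by right; exists (u + d); [exact: AD|exists b => //; rewrite addrA].
  - by right; exists (c + v); [exact: AD|exists a => //; rewrite addrAC].
  right; exists (c + d); first exact: AD.
  by exists (a + b); [exact: addr_gt0|rewrite scalerDl addrACA].
move=> [Au|[c Ac [b b0 ->]]]; first by left; exact: AZ.
right; exists (a *: c); first exact: AZ.
by exists (a * b); [exact: mulr_gt0|rewrite scalerDr scalerA].
Qed.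

(* [L h] is the largest [t] with [h - t e] in a maximal cone containing [C0]
   but not [- e]; maximality makes this superadditive map odd. *)
Lemma order_unit_positive_functional (W C0 : set V) (e : V) :
    (forall a b u v, W u -> W v -> W (a *: u + b *: v)) ->
    convex_cone C0 -> C0 0 -> W e -> C0 e -> ~ C0 (- e) ->
    (forall h, W h -> exists t, C0 (h + t *: e)) ->
  exists L : V -> R, [/\ L e = 1, forall u, W u -> C0 u -> 0 <= L u
    & forall a b u v, W u -> W v -> L (a *: u + b *: v) = a * L u + b * L v].
Proof.
move=> Wlin C0cone C00 We C0e C0Ne C0unit.
have WN u : W u -> W (- u).
  by move=> Wu; have := Wlin (-1) 0 u u Wu Wu; rewrite scale0r addr0 scaleN1r.
have WD u v : W u -> W v -> W (u + v).
  by move=> Wu Wv; have := Wlin 1 1 u v Wu Wv; rewrite !scale1r.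
have WZ a u : W u -> W (a *: u).
  by move=> Wu; have := Wlin a 0 u u Wu Wu; rewrite scale0r addr0.
have [C [[CD CZ] C0C CNe] Cmax] := maximal_cone C0cone C00 C0Ne.
have CZe t : 0 <= t -> C (t *: e).
  rewrite le_eqVlt => /predU1P[<-|t0]; last exact/CZ/C0C.
  by rewrite scale0r; exact: C0C.
have Cte t : C (t *: e) -> 0 <= t.
  move=> Ct; rewrite leNgt; apply/negP => t0; apply: CNe.
  have -> : - e = (- t^-1) *: (t *: e).
    by rewrite scalerA mulNr mulVf ?lt_eqF// scaleN1r.
  by apply: CZ => //; rewrite oppr_gt0 invr_lt0.
(* If [h] is not in [C], then [- e = c + a *: h], so [- h] is a positive multiple of [c + e]. *)
have Ctotal h : C h \/ C (- h).
  have [|/Cmax[c Cc [a a0 eE]]] := pselect (C h); first by left.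
  right; have -> : - h = a^-1 *: (c + e).
    rewrite -(opprK e) eE opprD addNKr -scalerN scalerA mulVf ?gt_eqF//.
    by rewrite scale1r.
  by apply: CZ; [rewrite invr_gt0|apply: CD => //; exact: C0C].
pose S h := [set t | C (h - t *: e)].
pose L h := sup (S h).
have S0 h : W h -> S h !=set0.
  by move=> /C0unit[t /C0C Ct]; exists (- t); rewrite /S/= scaleNr opprK.
(* Some [- h + t *: e] is in [C]; adding [h - s *: e] gives [(t - s) *: e], hence [s <= t]. *)
have Sub h : W h -> has_ubound (S h).
  move=> /WN/C0unit[t /C0C Ct]; exists t => s; rewrite /S/= => Cs.
  rewrite -subr_ge0; apply: Cte; rewrite scalerBl.
  have -> : t *: e - s *: e = (- h + t *: e) + (h - s *: e).
    by rewrite addrACA addNr add0r.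
  exact: CD.
have Lub h t : W h -> C (h - t *: e) -> t <= L h.
  by move=> Wh Ct; apply: ub_le_sup => //; exact: Sub.
have Lle h r : W h -> (forall t, C (h - t *: e) -> t <= r) -> L h <= r.
  by move=> Wh Ct; apply: ge_sup => //; exact: S0.
have LD h k : W h -> W k -> L h + L k <= L (h + k).
  move=> Wh Wk; rewrite -lerBrDr; apply: (Lle) => // s Cs.
  rewrite lerBrDr -lerBrDl; apply: (Lle) => // t Ct.
  rewrite lerBrDl; apply: Lub; first exact: WD.
  by rewrite scalerDl opprD addrACA; exact: CD.
have LZ0 a h : 0 < a -> W h -> a * L h <= L (a *: h).
  move=> a0 Wh; rewrite -ler_pdivlMl//; apply: (Lle) => // t Ct.
  rewrite ler_pdivlMl//; apply: Lub; first exact: WZ.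
  by rewrite -scalerA -scalerBr; exact: CZ.
have W0 : W 0 by rewrite -(scale0r e); exact: WZ.
have L0 : L 0 = 0.
  apply/eqP; rewrite eq_le; apply/andP; split; last first.
    by apply: Lub => //; rewrite scale0r subr0; exact: C0C.
  apply: (Lle) => // t; rewrite sub0r -scaleNr => /Cte.
  by rewrite oppr_ge0.
have LN h : W h -> L (- h) = - L h.
  move=> Wh; apply/eqP; rewrite eq_le; apply/andP; split.
    have := LD h (- h) Wh (WN _ Wh); rewrite subrr L0.
    by rewrite addrC -lerBrDr sub0r.
  rewrite lerNl; apply/ler_addgt0Pr => d d0.
  (* By totality this element or its negative lies in [C]. The first case is the claim up to [d];
     the second would give [L (- h) + d <= L (- h)]. *)
  have [/Lub -/(_ Wh)|] := Ctotal (h - (- L (- h) - d) *: e); first by lra.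
  rewrite opprB addrC -[X in - h + X]opprK -scaleNr.
  by move=> /Lub -/(_ (WN _ Wh)); lra.
have LDE h k : W h -> W k -> L (h + k) = L h + L k.
  move=> Wh Wk; apply/eqP; rewrite eq_le LD// andbT.
  have := LD (- h) (- k) (WN _ Wh) (WN _ Wk).
  by rewrite -opprD !LN//; [lra|exact: WD].
have LZp a h : 0 < a -> W h -> L (a *: h) = a * L h.
  move=> a0 Wh; apply/eqP; rewrite eq_le LZ0// andbT.
  rewrite -ler_pdivrMl//; apply: le_trans (LZ0 a^-1 _ _ (WZ a _ Wh)) _.
    by rewrite invr_gt0.
  by rewrite scalerA mulVf ?gt_eqF// scale1r.
have LZ a h : W h -> L (a *: h) = a * L h.
  move=> Wh; have [a0|a0|->] := ltgtP a 0; last by rewrite scale0r L0 mul0r.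
    rewrite -[a]opprK scaleNr LN; last exact: WZ.
    by rewrite LZp ?oppr_gt0// -mulNr.
  exact: LZp.
exists L; split.
- apply/eqP; rewrite eq_le; apply/andP; split.
    apply: (Lle) => // t; rewrite -{1}(scale1r e) -scalerBl => /Cte.
    by rewrite subr_ge0.
  by apply: Lub => //; rewrite scale1r subrr; exact: C0C.
- by move=> u Wu Cu; apply: Lub => //; rewrite scale0r subr0; exact: C0C.
- by move=> a b u v Wu Wv; rewrite LDE ?LZ//; exact: WZ.
Qed.

End cone_functional.

(** * Compactly supported functions *)

(* Compactness as an induction principle for ideals of sets. *)
Lemma compact_ideal (T : topologicalType) (K : set T) (P : set (set T)) :
    compact K -> P set0 -> (forall A B, A `<=` B -> P B -> P A) ->
    (forall A B, P A -> P B -> P (A `|` B)) ->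
    (forall x, K x -> exists2 A, nbhs x A & P A) ->
  P K.
Proof.
move=> cK P0 Psub PU Ploc; apply: contrapT => nPK.
(* If [K] is not in the ideal, these sets form a proper filter containing [K]. At a cluster point, a
   neighbourhood in the ideal has its complement in the filter, a contradiction. *)
pose F : set_system T := [set A | P (K `\` A)].
have FF : ProperFilter F.
  split; first by rewrite /F/= setD0.
  split; first by rewrite /F/= setDT.
  - by move=> A B FA FB; rewrite /F/= setDIr; exact: PU.
  - by move=> A B AB; apply: Psub; exact: setDS.
have [|x [Kx clx]] := cK F FF; first by rewrite /F/= setDv.
have [A xA PA] := Ploc x Kx.
have FA : F (~` A) by rewrite /F/= setDE setCK; apply: Psub PA; exact: subIsetr.
by have [y []] := clx _ _ FA xA.
Qed.

Section compactly_supported.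
Context (R : realType) (X : topologicalType).
Implicit Types (f g : X -> R) (U K : set X).

Definition vanishes_off K f := forall x, ~ K x -> f x = 0.

Definition compactly_supported : set (X -> R) :=
  [set f | continuous f /\ exists2 K, compact K & vanishes_off K f].

(* Rudin's [f < U], written with a compact set in place of the closure of
   [f != 0]. *)
Definition subordinate U f :=
  [/\ continuous f, forall x, 0 <= f x <= 1
    & exists2 K, compact K /\ K `<=` U & vanishes_off K f].

Lemma open_superlevel f c : continuous f -> open [set x | c < f x].
Proof.
move=> cf; apply: (@open_comp _ _ f [set y | c < y]) => [x _|].
  exact: cf.
exact: open_gt.
Qed.

Lemma closed_superlevel f c : continuous f -> closed [set x | c <= f x].
Proof.
move=> cf; apply: (@preimage_closed _ _ f [set y | c <= y]) => [x _|].
  exact: cf.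
exact: closed_ge.
Qed.

Lemma subordinate_cs U f : subordinate U f -> compactly_supported f.
Proof. by move=> [cf _ [K [cK _] Kf]]; split => //; exists K. Qed.

Lemma subordinateS U V f : U `<=` V -> subordinate U f -> subordinate V f.
Proof.
move=> UV [cf f01 [K [cK KU] Kf]]; split => //; exists K => //; split => //.
exact: subset_trans UV.
Qed.

Lemma subordinate0 U : subordinate U (fun=> 0).
Proof.
split; first exact: cst_continuous.
  by move=> x; rewrite lexx ler01.
by exists set0 => //; split; [exact: compact0|exact: sub0set].
Qed.

Lemma subordinate_comp (h k : X -> X) U f :
    cancel h k -> cancel k h -> continuous h -> continuous k ->
  subordinate U f -> subordinate (h @^-1` U) (f \o h).
Proof.
move=> hk kh ch ck [cf f01 [K [cK KU] Kf]]; split.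
- by move=> x; apply: continuous_comp; [exact: ch|exact: cf].
- by move=> x; exact: f01.
exists (k @` K).
  split; first by apply: continuous_compact => //; exact: continuous_subspaceT.
  by move=> _ [x Kx <-]; rewrite /= kh; exact: KU.
by move=> x nKx; apply: Kf => Khx; apply: nKx; exists (h x) => //; rewrite hk.
Qed.

Lemma subordinate_max U f g :
  subordinate U f -> subordinate U g -> subordinate U (f \max g).
Proof.
move=> [cf f01 [K [cK KU] Kf]] [cg g01 [L [cL LU] Lg]]; split.
- exact: max_fun_continuous.
- move=> x; have /andP[f0 f1] := f01 x; have /andP[g0 g1] := g01 x.
  by rewrite /= le_max f0 /= ge_max f1.
exists (K `|` L).
  by split; [exact: compactU|rewrite subUset].
move=> x /= /not_orP[Kx Lx].
by rewrite Kf// Lg// maxxx.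
Qed.

Lemma cs_comp (h k : X -> X) f :
    cancel h k -> cancel k h -> continuous h -> continuous k ->
  compactly_supported f -> compactly_supported (f \o h).
Proof.
move=> hk kh ch ck [cf [K cK Kf]]; split.
  by move=> x; apply: continuous_comp; [exact: ch|exact: cf].
exists (k @` K).
  by apply: continuous_compact => //; exact: continuous_subspaceT.
by move=> x nKx; apply: Kf => Khx; apply: nKx; exists (h x) => //; rewrite hk.
Qed.

Lemma cs_lin (a b : R) f g : compactly_supported f -> compactly_supported g ->
  compactly_supported (a *: f + b *: g).
Proof.
move=> [cf [K cK Kf]] [cg [L cL Lg]]; split.
  move=> x; apply: continuousD; apply: continuousZ => //=;
    by [exact: cst_continuous|exact: cf|exact: cg].
exists (K `|` L); first exact: compactU.
move=> x /not_orP[Kx Lx].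
by rewrite !fctE Kf// Lg// !scaler0 addr0.
Qed.

Lemma cs0 : compactly_supported (0 : X -> R).
Proof. exact: (subordinate_cs (subordinate0 set0)). Qed.

Lemma cs_sum (I : eqType) (s : seq I) (F : I -> X -> R) :
    (forall i, i \in s -> compactly_supported (F i)) ->
  compactly_supported (\sum_(i <- s) F i).
Proof.
elim: s => [_|i s IHs sF]; first by rewrite big_nil; exact: cs0.
rewrite big_cons -[F i]scale1r -[X in _ + X]scale1r; apply: cs_lin.
  by apply: sF; rewrite mem_head.
by apply: IHs => j js; apply: sF; rewrite in_cons js orbT.
Qed.

(** If [f] is nonnegative somewhere on [K], its maximum over [K] is global. Otherwise either [f] is
    negative everywhere and [K] is the whole space, or the maximum is the value 0 taken off [K]. *)
Lemma cs_argmax f : compactly_supported f -> [set: X] !=set0 ->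
  exists x, forall y, f y <= f x.
Proof.
move=> [cf [K cK Kf]] [x0 _].
have [[x fx0]|fneg] := pselect (exists x, 0 <= f x); last first.
  have KT : K = setT.
    rewrite -subTset => x _; apply: contrapT => Kx; apply: fneg.
    by exists x; rewrite Kf.
  have [|//||c _ fc] := @compact_EVT_max X R f K.
  - by exists x0; rewrite KT.
  - exact: continuous_subspaceT.
  by exists c => y; apply: fc; rewrite KT in_setT.
have [[y [Ky fy0]]|fK] := pselect (exists y, K y /\ 0 <= f y).
  have [|//||c Kc fc] := @compact_EVT_max X R f K; first by exists y.
    exact: continuous_subspaceT.
  exists c => z; have [Kz|/Kf->] := pselect (K z).
    by apply: fc; exact/mem_set.
  by apply: le_trans fy0 _; apply: fc; exact/mem_set.
have Kx : ~ K x by move=> Kx; apply: fK; exists x.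
exists x => y; rewrite (Kf _ Kx); have [Ky|/Kf->//] := pselect (K y).
by rewrite leNgt; apply/negP => /ltW fy; apply: fK; exists y.
Qed.

(** * Urysohn functions on a locally compact Hausdorff space *)

Section urysohn.
Hypotheses (lcX : locally_compact [set: X]) (hX : hausdorff_space X).

Let near1 U A := exists f W,
  [/\ subordinate U f, open W, A `<=` W & forall x, W x -> f x = 1].

Let near1_pt U x : open U -> U x -> exists2 A, nbhs x A & near1 U A.
Proof.
move=> oU Ux.
have [N] := @lcX x Logic.I; rewrite withinET => xN [cN clN].
pose V := U `&` N°.
have oV : open V by apply: openI => //; exact: open_interior.
have Vx : V x by split.
have : uniform_separator [set x] (~` V).
  apply: (@locally_compact_completely_regular X R) => //.
  exact: open_closedC.
move=> /(uniform_separatorP (R := R))[f [cf f01 fx fV]].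
(* Since [f] is 0 at [x] and 1 off [V], [g] is 2 at [x] and -1 off [V]. Clipped to [0, 1], it is 1
   near [x] and vanishes off the set where [0 <= g], a closed subset of the compact [N]. *)
pose g : X -> R := cst 2 - cst 3 \* f.
have gE y : g y = 2 - 3 * f y by [].
have cg : continuous g.
  move=> y; apply: continuousB; first exact: cst_continuous.
  by apply: continuousM; [exact: cst_continuous|exact: cf].
have gx : g x = 2 by rewrite gE (fx (f x)) ?mulr0 ?subr0//; exists x.
exists [set y | 1 < g y].
  apply: open_nbhs_nbhs; split; last by rewrite /= gx; lra.
  exact: open_superlevel.
exists ((fun=> 0) \max ((fun=> 1) \min g)), [set y | 1 < g y]; split => //.
- split.
  + apply: max_fun_continuous; first exact: cst_continuous.
    by apply: min_fun_continuous => //; exact: cst_continuous.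
  + by move=> y /=; rewrite le_max lexx/= ge_max ler01 ge_min lexx.
  exists [set y | 0 <= g y]; last first.
    move=> y /= /negP; rewrite -ltNge => gy.
    by rewrite min_r ?max_l// ltW// (lt_trans gy).
  have gV : [set y | 0 <= g y] `<=` V.
    move=> y /= gy; apply: contrapT => nVy; move: gy.
    by rewrite gE (fV (f y)); [lra|exists y].
  split; last by move=> y /gV[].
  apply: (subclosed_compact _ cN); last by move=> y /gV[_ /interior_subset].
  exact: closed_superlevel.
- exact: open_superlevel.
- by move=> y /= gy; rewrite min_l ?max_r// ltW.
Qed.

(** Local functions are glued by [\max]. That [f] is 1 on an open [W] around [K], not only on [K],
    serves later to bound the measure of [K] and to keep supports compact by removing [W]. *)
Lemma urysohn_compact K U : compact K -> open U -> K `<=` U ->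
  exists f W, [/\ subordinate U f, open W, K `<=` W & forall x, W x -> f x = 1].
Proof.
move=> cK oU KU; apply: (compact_ideal (P := near1 U)) => //.
- by exists (fun=> 0), set0; split; [exact: subordinate0|exact: open0| |].
- move=> A B AB [f [W [Uf oW BW W1]]]; exists f, W; split => //.
  exact: subset_trans BW.
- move=> A B [f [W [Uf oW AW W1]]] [g [Z [Ug oZ BZ Z1]]].
  exists (f \max g), (W `|` Z); split; first exact: subordinate_max.
  + exact: openU.
  + exact: setUSS.
  have [_ f01 _] := Uf; have [_ g01 _] := Ug.
  move=> x /= [/W1|/Z1] ->; first by rewrite max_l//; case/andP: (g01 x).
  by rewrite max_r//; case/andP: (f01 x).
- by move=> x /KU; exact: near1_pt.
Qed.

End urysohn.

End compactly_supported.

(** * Riesz representation *)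

Section riesz.
Context (R : realType) (X : ptopologicalType) (L : (X -> R) -> R).
Implicit Types (f g : X -> R) (U V A B : set X).

Local Notation cs := (@compactly_supported R X).

Hypotheses (lcX : locally_compact [set: X]) (hX : hausdorff_space X).
Hypothesis L_linear : forall (a b : R) f g, cs f -> cs g ->
  L (a *: f + b *: g) = a * L f + b * L g.
Hypothesis L_ge0 : forall f, cs f -> (forall x, 0 <= f x) -> 0 <= L f.

Let LD f g : cs f -> cs g -> L (f + g) = L f + L g.
Proof.
by move=> cf cg; have := L_linear 1 1 cf cg; rewrite !scale1r !mul1r.
Qed.

Let L0 : L 0 = 0.
Proof.
have := L_linear 0 0 (@cs0 R X) (@cs0 R X).
by rewrite !scale0r addr0 !mul0r addr0.
Qed.

Lemma le_functional f g : cs f -> cs g -> (forall x, f x <= g x) -> L f <= L g.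
Proof.
move=> cf cg fg; rewrite -subr_ge0.
have := L_linear 1 (-1) cg cf; rewrite scale1r scaleN1r mul1r mulN1r => <-.
apply: L_ge0 => [|x]; last by rewrite !fctE subr_ge0.
by have := cs_lin 1 (-1) cg cf; rewrite scale1r scaleN1r.
Qed.

Definition riesz_open U : \bar R :=
  ereal_sup [set (L f)%:E | f in subordinate U].

(** Defined on every subset, as the Caratheodory construction requires. *)
Definition riesz_outer A : \bar R :=
  ereal_inf [set riesz_open U | U in [set U | open U /\ A `<=` U]].

Lemma riesz_open_ub U f : subordinate U f -> ((L f)%:E <= riesz_open U)%E.
Proof. by move=> fU; apply: ereal_sup_ubound; exists f. Qed.

Lemma riesz_open_le U (r : \bar R) :
  (forall f, subordinate U f -> ((L f)%:E <= r)%E) -> (riesz_open U <= r)%E.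
Proof. by move=> Ur; apply: ge_ereal_sup => _ [f fU <-]; exact: Ur. Qed.

Lemma riesz_open_ge0 U : (0 <= riesz_open U)%E.
Proof. by have := riesz_open_ub (subordinate0 R U); rewrite L0. Qed.

Lemma le_riesz_open U V : U `<=` V -> (riesz_open U <= riesz_open V)%E.
Proof.
move=> UV; apply: riesz_open_le => f fU.
by apply: riesz_open_ub; exact: subordinateS fU.
Qed.

Lemma riesz_open0 : riesz_open set0 = 0%E.
Proof.
apply/eqP; rewrite eq_le riesz_open_ge0 andbT.
apply: riesz_open_le => f [_ _ [K [_ K0] Kf]].
have -> : f = 0; last by rewrite L0.
by apply/funext => x; apply: Kf => /K0.
Qed.

(** A partition of unity: with [h] subordinate to [U] and equal to 1 near the part of the support of
    [f] outside [V], the function [f] splits into [f h], subordinate to [U], and [f (1 - h)],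
    subordinate to [V]. *)
Lemma riesz_openU U V : open U -> open V ->
  (riesz_open (U `|` V) <= riesz_open U + riesz_open V)%E.
Proof.
move=> oU oV; apply: riesz_open_le => f fUV.
have [cf f01 [K [cK KUV] Kf]] := fUV.
have [|||h [W [[ch h01 [H [cH HU] Hh]] oW KW W1]]] :=
    @urysohn_compact R X lcX hX (K `\` V) U.
- apply: (subclosed_compact _ cK); last exact: subIsetl.
  by apply: closedI; [exact: compact_closed|exact: open_closedC].
- by [].
- by move=> x [/KUV[]].
have fhU : subordinate U (f \* h).
  split; first by move=> x; apply: continuousM; [exact: cf|exact: ch].
    move=> x; have /andP[f0 f1] := f01 x; have /andP[h0 h1] := h01 x.
    by rewrite /= mulr_ge0//= mulr_ile1.
  by exists H => // x /Hh; rewrite /= => ->; rewrite mulr0.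
have fhV : subordinate V (f \* (cst 1 - h)).
  split.
  - move=> x; apply: continuousM; first exact: cf.
    by apply: continuousB; [exact: cst_continuous|exact: ch].
  - move=> x; have /andP[f0 f1] := f01 x; have /andP[h0 h1] := h01 x.
    by rewrite /= !fctE mulr_ge0 ?subr_ge0//= mulr_ile1 ?subr_ge0// gerBl.
  exists (K `\` W).
    split; last first.
      by move=> x [Kx nWx]; apply: contrapT => nVx; apply: nWx; exact: KW.
    apply: (subclosed_compact _ cK); last exact: subIsetl.
    by apply: closedI; [exact: compact_closed|exact: open_closedC].
  move=> x nKW; rewrite /= !fctE.
  have [Kx|/Kf->] := pselect (K x); last by rewrite mul0r.
  have /W1 -> : W x by apply: contrapT => nWx; exact: nKW.
  by rewrite subrr mulr0.
have -> : f = f \* h + f \* (cst 1 - h).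
  by apply/funext => x; rewrite !fctE /= -mulrDr subrKC mulr1.
rewrite LD; [|exact: subordinate_cs fhU|exact: subordinate_cs fhV].
by rewrite EFinD leeD// riesz_open_ub.
Qed.

(** The compact support of each competing [f] is already covered by finitely many [U n]. *)
Lemma riesz_open_bigcup (U : nat -> set X) : (forall n, open (U n)) ->
  (riesz_open (\bigcup_n U n) <= \sum_(n <oo) riesz_open (U n))%E.
Proof.
move=> oU; apply: riesz_open_le => f [cf f01 [K [cK KU] Kf]].
have [n Kn] : exists n, K `<=` \big[setU/set0]_(i < n) U i.
  have mono m n : (m <= n)%N ->
      \big[setU/set0]_(i < m) U i `<=` \big[setU/set0]_(i < n) U i.
    exact: subset_bigsetU.
  apply: (compact_ideal (P := fun A =>
    exists n, A `<=` \big[setU/set0]_(i < n) U i)) => //.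
  - by exists 0%N.
  - by move=> A B AB [n Bn]; exists n; exact: subset_trans Bn.
  - move=> A B [m Am] [n Bn]; exists (maxn m n); rewrite subUset; split.
      by apply: subset_trans Am _; apply: mono; exact: leq_maxl.
    by apply: subset_trans Bn _; apply: mono; exact: leq_maxr.
  move=> x /KU[n _ Ux]; exists (U n); first exact: open_nbhs_nbhs.
  by exists n.+1; rewrite big_ord_recr/=; exact: subsetUr.
apply: (@le_trans _ _ (riesz_open (\big[setU/set0]_(i < n) U i))).
  by apply: riesz_open_ub; split => //; exists K.
apply: (@le_trans _ _ (\sum_(0 <= i < n) riesz_open (U i))%E); last first.
  by apply: nneseries_lim_ge => i _ _; exact: riesz_open_ge0.
rewrite big_mkord; elim: n {Kn} => [|n IHn].
  by rewrite !big_ord0 riesz_open0.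
rewrite !big_ord_recr/=; apply: le_trans (riesz_openU _ _) _ => //.
  by rewrite -bigcup_mkord; apply: bigcup_open => i _; exact: oU.
exact: leeD.
Qed.

Lemma riesz_outer_lb A U : open U -> A `<=` U ->
  (riesz_outer A <= riesz_open U)%E.
Proof. by move=> oU AU; apply: ereal_inf_lbound; exists U. Qed.

Lemma riesz_outer_ge A (r : \bar R) :
    (forall U, open U -> A `<=` U -> (r <= riesz_open U)%E) ->
  (r <= riesz_outer A)%E.
Proof.
by move=> rU; apply: le_ereal_inf_tmp => _ [U [oU AU] <-]; exact: rU.
Qed.

Lemma riesz_outer_open U : open U -> riesz_outer U = riesz_open U.
Proof.
move=> oU; apply/eqP; rewrite eq_le riesz_outer_lb//=.
by apply: riesz_outer_ge => V oV; exact: le_riesz_open.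
Qed.

Lemma riesz_outer_ge0 A : (0 <= riesz_outer A)%E.
Proof. by apply: riesz_outer_ge => U _ _; exact: riesz_open_ge0. Qed.

Lemma le_riesz_outer A B : A `<=` B -> (riesz_outer A <= riesz_outer B)%E.
Proof.
move=> AB; apply: riesz_outer_ge => U oU BU; apply: riesz_outer_lb => //.
exact: subset_trans BU.
Qed.

Lemma riesz_outer0 : riesz_outer set0 = 0%E.
Proof. by rewrite riesz_outer_open ?riesz_open0//; exact: open0. Qed.

Lemma riesz_outer_sigma_subadditive : sigma_subadditive riesz_outer.
Proof.
move=> F.
have [[i Foo]|Ffin] := pselect (exists i, riesz_outer (F i) = +oo%E).
  rewrite (eseries_pinfty (k := i)) ?leey// => n _.
  by rewrite gt_eqF// (lt_le_trans _ (riesz_outer_ge0 _)).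
apply/lee_addgt0Pr => e e0.
apply: le_trans (epsilon_trick _ _ (ltW e0)); last first.
  by move=> n; exact: riesz_outer_ge0.
have /choice[U UP] n : exists U, [/\ open U, F n `<=` U &
    (riesz_open U <= riesz_outer (F n) + (e / (2 ^ n.+1)%:R)%:E)%E].
  have Fn : riesz_outer (F n) \is a fin_num.
    rewrite ge0_fin_numE ?riesz_outer_ge0// ltey.
    by apply/negP => /eqP Foo; apply: Ffin; exists n.
  have e2 : 0 < e / (2 ^ n.+1)%:R :> R by rewrite divr_gt0// ltr0n expn_gt0.
  have [_ [U [oU FU] <-] /ltW] := lb_ereal_inf_adherent e2 Fn.
  by exists U; split.
apply: (@le_trans _ _ (riesz_open (\bigcup_n U n))).
  apply: riesz_outer_lb; first by apply: bigcup_open => n _; have [] := UP n.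
  by apply: subset_bigcup => n _; have [] := UP n.
apply: le_trans (riesz_open_bigcup _) _; first by move=> n; have [] := UP n.
by apply: lee_nneseries => n *; [exact: riesz_open_ge0|have [] := UP n].
Qed.

(** The Caratheodory criterion for open sets. For open [V] containing [A], take [f] subordinate to
    [V] and [U] with support in [K], then [g] subordinate to [V] minus [K], an open set containing
    [A] minus [U]. As the supports are disjoint, [g + f] is still at most 1 and subordinate to
    [V]. *)
Lemma riesz_outer_split A U : open U ->
  (riesz_outer (A `&` U) + riesz_outer (A `&` ~` U) <= riesz_outer A)%E.
Proof.
move=> oU; apply: riesz_outer_ge => V oV AV.
have [->|Voo] := eqVneq (riesz_open V) +oo%E; first exact: leey.
have outV : (riesz_outer (A `&` ~` U) <= riesz_open V)%E.
  by apply: riesz_outer_lb => // x [/AV].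
have fin_out : riesz_outer (A `&` ~` U) \is a fin_num.
  by rewrite ge0_fin_numE ?riesz_outer_ge0// (le_lt_trans outV)// ltey.
apply: (@le_trans _ _ (riesz_open (V `&` U) + riesz_outer (A `&` ~` U))%E).
  rewrite leeD2r// riesz_outer_lb//; first exact: openI.
  exact: setSI.
rewrite -leeBrDr//; apply: riesz_open_le => f fVU.
have [cf f01 [K [cK KVU] Kf]] := fVU.
rewrite leeBrDr// addeC -leeBrDr//.
have oVK : open (V `\` K).
  by apply: openI => //; apply: closed_openC; exact: compact_closed.
apply: (@le_trans _ _ (riesz_open (V `\` K))).
  apply: riesz_outer_lb => // x [/AV Vx nUx]; split => // /KVU[].
  by move=> _ /nUx.
apply: riesz_open_le => g gVK; rewrite leeBrDr// -EFinD.
rewrite -LD; [|exact: subordinate_cs gVK|exact: subordinate_cs fVU].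
apply: riesz_open_ub; have [cg g01 [M [cM MVK] Mg]] := gVK; split.
- by move=> x; apply: continuousD; [exact: cg|exact: cf].
- move=> x; rewrite fctE; have [Kx|/Kf->] := pselect (K x).
    by rewrite Mg ?add0r// => /MVK[_]; exact.
  by rewrite addr0.
- exists (M `|` K); first split; first exact: compactU.
    by rewrite subUset; split=> [x /MVK[]|x /KVU[]].
  by move=> x /not_orP[Mx Kx]; rewrite fctE Mg// Kf// addr0.
Qed.

Lemma riesz_measure :
  exists lambda : {measure set (borel X) -> \bar R}, lambda =1 riesz_outer.
Proof.
pose om : {outer_measure set X -> \bar R} := HB.pack riesz_outer
  (isOuterMeasure.Build R X riesz_outer riesz_outer0 riesz_outer_ge0
    le_riesz_outer riesz_outer_sigma_subadditive).
have borel_cara A : (measurable : set (set (borel X))) A ->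
    (measurable : set (set (caratheodory_type om))) A.
  apply: smallest_sub => [|U oU]; first exact: sigma_algebra_measurable.
  by apply: le_caratheodory_measurable => B; exact: riesz_outer_split.
have sadd : semi_sigma_additive (riesz_outer : set (borel X) -> \bar R).
  move=> F mF tF mUF.
  apply: (@caratheodory_measure_sigma_additive R X om) => //.
    by move=> i; exact: borel_cara.
  exact: borel_cara.
pose lambda : {measure set (borel X) -> \bar R} :=
  HB.pack (riesz_outer : set (borel X) -> \bar R)
    (isMeasure.Build _ (borel X) R (riesz_outer : set (borel X) -> \bar R)
       riesz_outer0 riesz_outer_ge0 sadd).
by exists lambda.
Qed.

(** On compact sets, [L h] bounds the measure when [h] is 1 near the set. Outer regularity is built
    in. For inner regularity, a function [f] supported in [K] is subordinate to every open set
    containing [K], so [L f] is at most the measure of [K]. *)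
Lemma riesz_radon (lambda : {measure set (borel X) -> \bar R}) :
  lambda =1 riesz_outer -> radon lambda.
Proof.
move=> lambdaE; split.
- move=> K cK; rewrite lambdaE.
  have [h [W [hT oW KW W1]]] :=
    urysohn_compact R lcX hX cK openT (@subsetT _ K).
  apply: le_lt_trans (riesz_outer_lb oW KW) _.
  apply: (@le_lt_trans _ _ (L h)%:E); last exact: ltey.
  apply: riesz_open_le => f fW; rewrite lee_fin.
  apply: le_functional; [exact: subordinate_cs fW|exact: subordinate_cs hT|].
  move=> x.
  have [_ f01 [M [_ MW] Mf]] := fW; have [_ h01 _] := hT.
  have [/MW/W1 ->|/Mf->] := pselect (M x); first by case/andP: (f01 x).
  by case/andP: (h01 x).
- move=> E _; rewrite lambdaE; congr ereal_inf.
  by apply/seteqP; split=> _ [U [oU EU] <-]; exists U => //;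
    rewrite lambdaE riesz_outer_open.
- move=> U oU; apply/eqP; rewrite eq_le; apply/andP; split; last first.
    by apply: ge_ereal_sup => _ [K [_ KU] <-]; rewrite !lambdaE;
      exact: le_riesz_outer.
  rewrite lambdaE riesz_outer_open//; apply: riesz_open_le => f [cf f01].
  move=> [K [cK KU] Kf]; apply: (@le_trans _ _ (lambda K)); last first.
    by apply: ereal_sup_ubound; exists K.
  rewrite lambdaE; apply: riesz_outer_ge => V oV KV.
  by apply: riesz_open_ub; split => //; exists K.
Qed.

End riesz.

(** * The random walk operator *)

Section stationary_functional.
Context (R : realType) (G : groupType) (X : ptopologicalType).
Variables (act : G -> X -> X) (s : seq G) (m : G -> R).
Implicit Types f u v : X -> R.

Local Notation cs := (@compactly_supported R X).

Hypotheses (act_homeo : acts_by_homeomorphisms act) (act_coc : cocompact act).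
Hypotheses (lcX : locally_compact [set: X]) (hX : hausdorff_space X).
Hypothesis m_gt0 : forall g, g \in s -> 0 < m g.
Hypothesis m_sum : \sum_(g <- s) m g = 1.
Hypothesis s_gen : semigroup_generated [set` s] = [set: G].

(** The operator [P]; [s] lists the support of the measure on the group and [m] gives its
    weights. *)
Definition walk f : X -> R := fun x => \sum_(g <- s) m g * f (act g x).

Lemma homeo_actK g : cancel (act g) (act g^-1%g).
Proof. by have [[a1 aM] _] := act_homeo => x; rewrite -aM mulVg a1. Qed.

Lemma homeo_actKV g : cancel (act g^-1%g) (act g).
Proof. by have [[a1 aM] _] := act_homeo => x; rewrite -aM mulgV a1. Qed.

Lemma act_continuous g : continuous (act g).
Proof. by have [_ /(_ g)[? []]] := act_homeo. Qed.

Lemma cs_act g f : cs f -> cs (f \o act g).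
Proof.
by apply: cs_comp (homeo_actK g) (homeo_actKV g) _ _; exact: act_continuous.
Qed.

Lemma walkE f : walk f = \sum_(g <- s) m g *: (f \o act g).
Proof. by apply/funext => x; rewrite fct_sumE. Qed.

Lemma cs_walk f : cs f -> cs (walk f).
Proof.
move=> cf; rewrite walkE; apply: cs_sum => g _.
rewrite -[X in cs X]addr0 -(scale0r (f \o act g)).
by apply: cs_lin; exact: cs_act.
Qed.

Lemma walk_lin a b f v : walk (a *: f + b *: v) = a *: walk f + b *: walk v.
Proof.
apply/funext => x; rewrite !fctE /walk !scaler_sumr -big_split/=.
by apply: eq_bigr => g _; rewrite mulrDr mulrCA [X in _ + X]mulrCA.
Qed.

Lemma walk_ge0 f x : (forall x, 0 <= f x) -> 0 <= walk f x.
Proof.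
move=> f0; rewrite /walk big_seq; apply: sumr_ge0 => g gs.
by rewrite mulr_ge0// ltW// m_gt0.
Qed.

Lemma walk_gt0 f g x : (forall x, 0 <= f x) -> g \in s ->
  0 < f (act g x) -> 0 < walk f x.
Proof.
move=> f0 gs fgx; rewrite lt_neqAle walk_ge0// andbT eq_sym.
apply/negP; rewrite /walk big_seq psumr_eq0 => [/allP/(_ g gs)|i /m_gt0 mi].
  by rewrite gs/= mulf_eq0 !gt_eqF// m_gt0.
by rewrite mulr_ge0// ltW.
Qed.

Lemma semigroup_ind (H : set G) : (forall g, g \in s -> H g) ->
  (forall g h, H g -> H h -> H (g * h)%g) -> forall g, H g.
Proof.
move=> sH HM g; have : semigroup_generated [set` s] g by rewrite s_gen.
exact: smallest_sub.
Qed.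

(* At a maximum of [f], [walk f >= f] forces [f] to be maximal along the whole
   orbit. *)
Lemma walk_max_principle f x :
    (forall y, f y <= f x) -> (forall y, f y <= walk f y) ->
  forall g, f (act g x) = f x.
Proof.
move=> fx fwalk g.
(* Quantifying over all maximum points [y] makes [H] closed under products. *)
pose H := [set g | forall y, f y = f x -> f (act g y) = f x].
suff : H g by apply.
apply: semigroup_ind => [{}g gs y fy|h k Hh Hk y fy]; last first.
  by have [[_ aM] _] := act_homeo; rewrite aM; apply/Hh/Hk.
apply/eqP; rewrite eq_le fx/= leNgt; apply/negP => fgy.
have : 0 < walk (cst (f x) - f) y.
  apply: (walk_gt0 _ gs) => [z|]; first by rewrite fctE subr_ge0.
  by rewrite fctE subr_gt0.
rewrite ltNge => /negP; apply.
rewrite /walk.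
under eq_bigr do rewrite fctE mulrBr.
by rewrite sumrB -mulr_suml m_sum mul1r subr_le0 -fy; exact: fwalk.
Qed.

(* Functions that every stationary functional must send to a nonnegative
   number. *)
Let C0 : set (X -> R) :=
  [set u | exists2 f, cs f & forall x, 0 <= u x + (walk f x - f x)].

Lemma stationary_functional : exists L : (X -> R) -> R,
  [/\ forall a b f v, cs f -> cs v -> L (a *: f + b *: v) = a * L f + b * L v,
      forall f, cs f -> (forall x, 0 <= f x) -> 0 <= L f,
      forall f, cs f -> L (walk f) = L f
    & exists2 phi, subordinate setT phi & L phi = 1].
Proof.
have [K cK KX] := act_coc.
have [phi [W [phiT _ KW W1]]] :=
  urysohn_compact R lcX hX cK openT (@subsetT _ K).
have cphi := subordinate_cs phiT.
have phi0 x : 0 <= phi x by have [_ /(_ x)/andP[]] := phiT.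
(* Cocompactness moves [x] into [K], where [phi] is 1. *)
have phi_orbit x : exists g, 0 < phi (act g x).
  have : setT x by []; rewrite KX => -[g _ [k /KW/W1 k1 <-]].
  by exists g^-1%g; rewrite homeo_actK k1.
have walk0 : walk 0 = 0.
  by have := walk_lin 0 0 0 0; rewrite !scale0r addr0.
have C0ge0 u : (forall x, 0 <= u x) -> C0 u.
  by move=> u0; exists 0; [exact: cs0|move=> x; rewrite walk0 subrr addr0].
have C0cone : convex_cone C0.
  split=> [u v [f cf uf] [g cg vg]|a u a0 [f cf uf]].
    exists (1 *: f + 1 *: g); first exact: cs_lin.
    move=> x; rewrite walk_lin !scale1r !fctE.
    by have := uf x; have := vg x; lra.
  exists (a *: f + 0 *: f); first exact: cs_lin.
  move=> x; rewrite walk_lin !scale0r !addr0 !fctE -scalerBr -scalerDr.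
  by rewrite mulr_ge0// ltW.
have C0Nphi : ~ C0 (- phi).
  move=> [f cf ff].
  have fwalk y : phi y <= walk f y - f y by have := ff y; rewrite fctE; lra.
  have [|x fx] := cs_argmax cf; first by exists point.
  have fmax y : f y <= walk f y by have := fwalk y; have := phi0 y; lra.
  have fconst := walk_max_principle fx fmax.
  have [g] := phi_orbit x; apply/negP; rewrite -leNgt.
  apply: (le_trans (fwalk _)); rewrite fconst subr_le0 /walk.
  under eq_bigr do rewrite -(proj2 (proj1 act_homeo)) fconst.
  by rewrite -mulr_suml m_sum mul1r.
(* [D] consists of the nonnegative functions bounded by a multiple of [phi] modulo [C0]. It serves
   to show that [phi] is an order unit although [phi] may vanish on parts of the support of a given
   [h]. *)
pose D : set (X -> R) :=
  [set u | [/\ cs u, forall x, 0 <= u x & exists t, C0 (t *: phi - u)]].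
have DD u v : D u -> D v -> D (u + v).
  move=> [cu u0 [a ua]] [cv v0 [b vb]]; split.
  - by have := cs_lin 1 1 cu cv; rewrite !scale1r.
  - by move=> x; rewrite fctE addr_ge0.
  - exists (a + b); rewrite scalerDl opprD addrACA.
    by have [CD _] := C0cone; exact: CD.
have DZ c u : 0 < c -> D u -> D (c *: u).
  move=> c0 [cu u0 [a ua]]; split.
  - by have := cs_lin c 0 cu cu; rewrite scale0r addr0.
  - by move=> x; rewrite fctE mulr_ge0// ltW.
  - exists (c * a); rewrite -scalerA -scalerBr.
    by have [_ CZ] := C0cone; exact: CZ.
have Dwalk u : D u -> D (walk u).
  move=> [cu u0 [a [f cf af]]]; split; first exact: cs_walk.
    by move=> x; exact: walk_ge0.
  (* Adding [u] to the witness contributes [walk u - u], which turns the bound for [u] into one for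
     [walk u]. *)
  exists a, (1 *: f + 1 *: u); first exact: cs_lin.
  move=> x; rewrite walk_lin !scale1r.
  by have := af x; rewrite !fctE; lra.
have Dphi : D phi.
  by split => //; exists 1; apply: C0ge0 => x; rewrite scale1r subrr.
(* If [u] is positive at [act g x] with [g] in [s], then [walk u] is positive at [x]. By
   nondegeneracy, repeated walking carries positivity of [phi] from one point to its whole orbit. *)
have Dpos x : exists2 u, D u & 0 < u x.
  have [g gx] := phi_orbit x.
  pose H := [set g | forall u x, D u -> 0 < u (act g x) ->
    exists2 v, D v & 0 < v x].
  suff : H g by apply; [exact: Dphi|].
  apply: semigroup_ind => [{x gx}g gs u x Du ux|{x gx}g h Hg Hh u x Du].
    exists (walk u); first exact: Dwalk.
    by have [_ u0 _] := Du; exact: walk_gt0 gs ux.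
  have [[_ aM] _] := act_homeo; rewrite aM.
  by move=> /(Hg _ _ Du)[v Dv]; exact: Hh.
have C0unit h : cs h -> exists t, C0 (h + t *: phi).
  move=> [ch [M cM Mh]].
  have [u Du hu] : exists2 u, D u & forall x, M x -> - h x <= u x.
    apply: (compact_ideal (P := fun A =>
      exists2 u, D u & forall x, A x -> - h x <= u x)) => //.
    - by exists phi.
    - by move=> A B AB [u Du Bu]; exists u => // x /AB/Bu.
    - move=> A B [u Du Au] [v Dv Bv]; exists (u + v); first exact: DD.
      have [_ u0 _] := Du; have [_ v0 _] := Dv.
      move=> x; have := u0 x; have := v0 x.
      by move=> ? ? [/Au|/Bv]; rewrite fctE; lra.
    move=> x _; have [u Du ux] := Dpos x.
    (* With this constant [h + c *: u] is at least 1 at [x], hence positive nearby; compactness of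
       [M] then yields a single [u]. *)
    pose c := (`|h x| + 1) / u x.
    have c0 : 0 < c by rewrite divr_gt0// ltr_wpDl.
    have Dcu := DZ _ _ c0 Du.
    have [[ccu _] _ _] := Dcu.
    exists [set y | 0 < (h + c *: u) y]; last first.
      exists (c *: u) => // y /= huy; rewrite -subr_ge0 opprK addrC; exact: ltW.
    apply: open_nbhs_nbhs; split.
      apply: open_superlevel => y; apply: continuousD; [exact: ch|exact: ccu].
    rewrite /= !fctE /c /GRing.scale/= divfK ?gt_eqF//.
    by have := ler_norm (- h x); rewrite normrN; lra.
  (* Off [M], [h] vanishes and [u] is nonnegative, so [h + u] is nonnegative everywhere and the
     bound of [u] by [t *: phi] transfers to [- h]. *)
  have [cu u0 [t [f cf tf]]] := Du; exists t, f => // x.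
  apply: le_trans (tf x) _; rewrite lerD2r !fctE addrC lerD2r.
  have [/hu|/Mh->] := pselect (M x); first by rewrite lerNl.
  by rewrite oppr_le0.
have [||L [Lphi LC0 Llin]] := order_unit_positive_functional
  (W := cs) _ C0cone _ cphi (C0ge0 _ phi0) C0Nphi C0unit.
- by move=> a b u v; exact: cs_lin.
- exact: C0ge0.
have Lsub f v : cs f -> cs v -> L (f - v) = L f - L v.
  move=> cf cv; have := Llin 1 (-1) f v cf cv.
  by rewrite scale1r scaleN1r mul1r mulN1r.
exists L; split => //.
- by move=> f cf f0; apply: LC0 => //; exact: C0ge0.
- move=> f cf; have cw := cs_walk cf.
  have csub u v : cs u -> cs v -> cs (u - v).
    by move=> cu cv; have := cs_lin 1 (-1) cu cv; rewrite scale1r scaleN1r.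
  apply/eqP; rewrite eq_le -subr_ge0 -[X in _ && X]subr_ge0 -!Lsub//.
  (* Both [f - walk f] and [walk f - f] lie in [C0], with witnesses [f] and [- f]. *)
  apply/andP; split; apply: LC0; try exact: csub.
    by exists f => // x; rewrite !fctE; lra.
  exists (0 *: f + (-1) *: f); first exact: cs_lin.
  move=> x; rewrite walk_lin scale0r add0r scale0r add0r !scaleN1r !fctE.
  lra.
- by exists phi.
Qed.

End stationary_functional.

(** * Stationarity of the representing measure *)

(** Directedness lets one index [z] nearly attain all the suprema at once. Once the right-hand side
    is finite, so are all terms, and they may be subtracted. *)
Lemma le_sum_ereal_sup_directed (R : realType) (T I : Type) (P : set T)
    (s : seq I) (F : I -> T -> \bar R) :
    P !=set0 -> (forall i x, P x -> (0 <= F i x)%E) ->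
    (forall x y, P x -> P y ->
      exists2 z, P z & forall i, (F i x <= F i z /\ F i y <= F i z)%E) ->
  (\sum_(i <- s) ereal_sup [set F i x | x in P] <=
   ereal_sup [set \sum_(i <- s) F i x | x in P])%E.
Proof.
move=> [x0 Px0] F0 Fdir; elim: s => [|i s IHs].
  by rewrite big_nil; apply: ereal_sup_ubound; exists x0 => //; rewrite big_nil.
rewrite big_cons; set S := ereal_sup [set \sum_(j <- i :: s) _ | _ in P].
apply: le_trans (leeD2l _ IHs) _.
have [->|Soo] := eqVneq S +oo%E; first exact: leey.
pose B x := (\sum_(j <- s) F j x)%E.
have B0 x : P x -> (0 <= B x)%E by move=> Px; apply: sume_ge0 => j _; exact: F0.
have FBS x y : P x -> P y -> (F i x + B y <= S)%E.
  move=> Px Py; have [z Pz zxy] := Fdir _ _ Px Py.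
  apply: (@le_trans _ _ (F i z + B z)%E).
    apply: leeD; first by case: (zxy i).
    by apply: lee_sum => j _; case: (zxy j).
  by apply: ereal_sup_ubound; exists z => //; rewrite big_cons.
have S_lt : (S < +oo)%E by rewrite ltey.
have Bfin x : P x -> B x \is a fin_num.
  move=> Px; rewrite ge0_fin_numE ?B0//; apply: le_lt_trans S_lt.
  by apply: le_trans (FBS _ _ Px Px); rewrite leeDr ?F0.
have Ffin x : P x -> F i x \is a fin_num.
  move=> Px; rewrite ge0_fin_numE ?F0//; apply: le_lt_trans S_lt.
  by apply: le_trans (FBS _ _ Px Px); rewrite leeDl ?B0.
have supB x : P x -> (F i x + ereal_sup [set B y | y in P] <= S)%E.
  move=> Px; rewrite -leeBrDl ?Ffin//; apply: ge_ereal_sup => _ [y Py <-].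
  by rewrite leeBrDl ?Ffin//; exact: FBS.
have supBfin : ereal_sup [set B y | y in P] \is a fin_num.
  rewrite ge0_fin_numE; last first.
    by apply: le_trans (B0 _ Px0) _; apply: ereal_sup_ubound; exists x0.
  apply: le_lt_trans S_lt; apply: le_trans (supB _ Px0).
  by rewrite leeDr ?F0.
rewrite -leeBrDr//; apply: ge_ereal_sup => _ [x Px <-].
by rewrite leeBrDr//; exact: supB.
Qed.

Lemma ge_sum_ereal_inf_directed (R : realType) (T I : Type) (P : set T)
    (s : seq I) (F : I -> T -> \bar R) :
    P !=set0 -> (forall i x, P x -> (0 <= F i x)%E) ->
    (forall x y, P x -> P y ->
      exists2 z, P z & forall i, (F i z <= F i x /\ F i z <= F i y)%E) ->
  (ereal_inf [set \sum_(i <- s) F i x | x in P] <=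
   \sum_(i <- s) ereal_inf [set F i x | x in P])%E.
Proof.
move=> [x0 Px0] F0 Fdir; elim: s => [|i s IHs].
  by rewrite big_nil; apply: ereal_inf_lbound; exists x0 => //; rewrite big_nil.
rewrite big_cons; set S := ereal_inf [set \sum_(j <- i :: s) _ | _ in P].
apply: le_trans (leeD2l _ IHs).
pose B x := (\sum_(j <- s) F j x)%E.
have B0 x : P x -> (0 <= B x)%E by move=> Px; apply: sume_ge0 => j _; exact: F0.
have FBS x y : P x -> P y -> (S <= F i x + B y)%E.
  move=> Px Py; have [z Pz zxy] := Fdir _ _ Px Py.
  apply: (@le_trans _ _ (F i z + B z)%E).
    by apply: ereal_inf_lbound; exists z => //; rewrite big_cons.
  apply: leeD; first by case: (zxy i).
  by apply: lee_sum => j _; case: (zxy j).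
set b := ereal_inf [set B y | y in P].
have b0 : (0 <= b)%E by apply: le_ereal_inf_tmp => _ [y Py <-]; exact: B0.
have [->|boo] := eqVneq b +oo%E.
  by rewrite addey ?leey// gt_eqF// (@lt_le_trans _ _ 0%E)//;
    apply: le_ereal_inf_tmp => _ [y Py <-]; exact: F0.
have bfin : b \is a fin_num by rewrite ge0_fin_numE// ltey.
rewrite -leeBlDr//; apply: le_ereal_inf_tmp => _ [x Px <-].
rewrite leeBlDr//.
have [->|Foo] := eqVneq (F i x) +oo%E.
  by rewrite addye ?leey// gt_eqF// (@lt_le_trans _ _ 0%E).
have Ffin : F i x \is a fin_num by rewrite ge0_fin_numE ?F0// ltey.
rewrite addeC -leeBlDr//; apply: le_ereal_inf_tmp => _ [y Py <-].
by rewrite leeBlDr// addeC; exact: FBS.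
Qed.

Section stationary_measure.
Context (R : realType) (G : groupType) (X : ptopologicalType).
Variables (act : G -> X -> X) (s : seq G) (m : G -> R) (L : (X -> R) -> R).

Hypothesis act_homeo : acts_by_homeomorphisms act.
Hypothesis m_ge0 : forall g, 0 <= m g.
Hypothesis m_gt0 : forall g, g \in s -> 0 < m g.
Hypothesis L_linear : forall (a b : R) f g, compactly_supported f ->
  compactly_supported g -> L (a *: f + b *: g) = a * L f + b * L g.
Hypothesis L_ge0 : forall f,
  compactly_supported f -> (forall x, 0 <= f x) -> 0 <= L f.
Hypothesis L_walk : forall f, compactly_supported f -> L (walk act s m f) = L f.

Local Notation homeo_actK := (homeo_actK act_homeo).
Local Notation homeo_actKV := (homeo_actKV act_homeo).
Local Notation act_continuous := (act_continuous act_homeo).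

Lemma functional_walkE f : compactly_supported f ->
  L f = \sum_(g <- s) m g * L (f \o act g).
Proof.
move=> cf; rewrite -L_walk// walkE.
have cfg g : compactly_supported (f \o act g) by exact: cs_act.
elim: (s) => [|g t IHt].
  rewrite !big_nil; have := L_linear 0 0 cf cf.
  by rewrite !scale0r addr0 !mul0r addr0.
have ct : compactly_supported (\sum_(h <- t) m h *: (f \o act h)).
  apply: cs_sum => h _; rewrite -[X in compactly_supported X]addr0.
  by rewrite -(scale0r (f \o act h)); exact: cs_lin.
have := L_linear (m g) 1 (cfg g) ct.
by rewrite !big_cons -IHt scale1r mul1r.
Qed.

(** Composition with [act g] is a bijection between the two families of subordinate functions. All
    translates thus become suprema over the same index set, as the directed exchange needs. *)
Lemma riesz_open_act g U : riesz_open L (act g @^-1` U) =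
  ereal_sup [set (L (f \o act g))%:E | f in subordinate U].
Proof.
congr ereal_sup; apply/seteqP; split=> _ [f fU <-]; last first.
  exists (f \o act g) => //.
  by apply: (subordinate_comp (homeo_actK g) (homeo_actKV g)) => //;
    exact: act_continuous.
exists (f \o act g^-1%g).
  have -> : U = act g^-1%g @^-1` (act g @^-1` U).
    by apply/seteqP; split=> x; rewrite /= homeo_actKV.
  by apply: (subordinate_comp (homeo_actKV g) (homeo_actK g)) => //;
    exact: act_continuous.
by congr (L _)%:E; apply/funext => x; rewrite /= homeo_actK.
Qed.

Lemma riesz_outer_act g A : riesz_outer L (act g @^-1` A) =
  ereal_inf [set riesz_open L (act g @^-1` U) | U in
    [set U | open U /\ A `<=` U]].
Proof.
congr ereal_inf; apply/seteqP; split=> _ [U [oU AU] <-]; last first.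
  exists (act g @^-1` U) => //; split; last by move=> x /AU.
  by apply: open_comp oU => x _; exact: act_continuous.
exists (act g^-1%g @^-1` U).
  split; first by apply: open_comp oU => x _; exact: act_continuous.
  by move=> x Ax; apply: AU; rewrite /= homeo_actKV.
by congr riesz_open; apply/seteqP; split=> x; rewrite /= homeo_actK.
Qed.

(** Take the supremum of [functional_walkE] over [f]. It commutes with the finite sum because [\max]
    makes the functions subordinate to [U] directed and [L] is monotone. *)
Lemma riesz_open_stationary U :
  (\sum_(g <- s) (m g)%:E * riesz_open L (act g @^-1` U) = riesz_open L U)%E.
Proof.
pose F g f := (m g * L (f \o act g))%:E.
have FE f : subordinate U f -> (\sum_(g <- s) F g f)%E = (L f)%:E.
  by move=> fU; rewrite sumEFin -functional_walkE//; exact: subordinate_cs fU.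
have cs_sub g (f : X -> R) : subordinate U f -> compactly_supported (f \o act g).
  by move=> fU; apply: cs_act => //; exact: subordinate_cs fU.
have L_act0 g f : subordinate U f -> 0 <= L (f \o act g).
  move=> fU; apply: L_ge0; first exact: cs_sub fU.
  by have [_ f01 _] := fU => x; case/andP: (f01 (act g x)).
have sE : (\sum_(g <- s) (m g)%:E * riesz_open L (act g @^-1` U) =
    \sum_(g <- s) ereal_sup [set F g f | f in subordinate U])%E.
  apply: eq_big_seq => g gs; rewrite riesz_open_act -ereal_sup_pZl ?m_gt0//.
  by congr ereal_sup; rewrite image_comp.
have supE : ereal_sup [set (\sum_(g <- s) F g f)%E | f in subordinate U] =
    riesz_open L U.
  by congr ereal_sup; apply/seteqP; split=> _ [f fU <-]; exists f => //;
    rewrite FE.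
rewrite sE; apply/eqP; rewrite eq_le; apply/andP; split.
  rewrite -supE; apply: le_sum_ereal_sup_directed => [|g f fU|f h fU hU].
  - by exists (fun=> 0); exact: subordinate0.
  - by rewrite lee_fin mulr_ge0// L_act0.
  exists (f \max h) => [|g]; first exact: subordinate_max.
  have fhU := subordinate_max fU hU.
  split; rewrite lee_fin ler_wpM2l//.
    apply: (le_functional L_linear L_ge0 (cs_sub g _ fU) (cs_sub g _ fhU)) => x /=.
    by rewrite le_max lexx.
  apply: (le_functional L_linear L_ge0 (cs_sub g _ hU) (cs_sub g _ fhU)) => x /=.
  by rewrite le_max lexx orbT.
apply: riesz_open_le => f fU; rewrite -FE//.
by apply: lee_sum => g _; apply: ereal_sup_ubound; exists f.
Qed.

(** The infimum over open neighbourhoods of [A] commutes with the sum because they are directed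
    under intersection. *)
Lemma riesz_outer_stationary A :
  (\sum_(g <- s) (m g)%:E * riesz_outer L (act g @^-1` A) = riesz_outer L A)%E.
Proof.
pose P := [set U : set X | open U /\ A `<=` U].
pose F g U := ((m g)%:E * riesz_open L (act g @^-1` U))%E.
have sE : (\sum_(g <- s) (m g)%:E * riesz_outer L (act g @^-1` A) =
    \sum_(g <- s) ereal_inf [set F g U | U in P])%E.
  apply: eq_big_seq => g gs; rewrite riesz_outer_act -ereal_inf_pZl ?m_gt0//.
  by congr ereal_inf; rewrite image_comp.
have infE : ereal_inf [set (\sum_(g <- s) F g U)%E | U in P] = riesz_outer L A.
  congr ereal_inf; apply/seteqP.
  by split=> _ [U PU <-]; exists U => //; rewrite riesz_open_stationary.
rewrite sE; apply/eqP; rewrite eq_le; apply/andP; split.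
  apply: riesz_outer_ge => U oU AU; rewrite -riesz_open_stationary.
  by apply: lee_sum => g _; apply: ereal_inf_lbound; exists U.
rewrite -infE; apply: ge_sum_ereal_inf_directed => [|g U _|U V [oU AU] [oV AV]].
- by exists setT; split; [exact: openT|exact: subsetT].
- by rewrite mule_ge0 ?lee_fin// riesz_open_ge0.
exists (U `&` V) => [|g].
  by split; [exact: openI|rewrite subsetI].
by split; rewrite lee_wpmul2l ?lee_fin//; apply: le_riesz_open => x [].
Qed.

End stationary_measure.

(** * Countability of the group and total mass of the atoms *)

Lemma semigroup_generated_surj (G : groupType) (s : seq G) :
    semigroup_generated [set` s] = [set: G] ->
  exists e : seq nat -> G, forall g, exists l, e l = g.
Proof.
move=> sT; pose e l := foldr (fun i g => (nth 1 s i * g)%g) 1%g l.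
exists e; apply: (semigroup_ind sT) => [g gs|_ _ [k <-] [l <-]].
  by exists [:: index g s]; rewrite /e/= nth_index// mulg1.
exists (k ++ l); elim: k => [|i k IHk]; first by rewrite mul1g.
by rewrite /e/= -/(e _) IHk mulgA.
Qed.

(** The group is countable, its elements being words in the support, so the complement of the
    support is a countable union of null singletons and carries no mass. *)
Lemma sum_supp (R : realType) (G : groupType)
    (mu : probability (discrete_group G) R) :
  finitely_supported mu -> nondegenerate_measure mu ->
  \sum_(g <- finmap.enum_fset (fset_set (supp mu))) fine (mu [set g]) = 1.
Proof.
move=> mu_fs mu_nd.
have [e e_surj] : exists e : seq nat -> G, forall g, exists l, e l = g.
  apply: (semigroup_generated_surj
    (s := finmap.enum_fset (fset_set (supp mu)))).
  by rewrite fset_setK.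
have mfin g : mu [set g] \is a fin_num by exact: fin_num_measure.
have mu0 : mu (~` supp mu) = 0%E.
  pose F n : set (discrete_group G) :=
    if unpickle n is Some l then [set e l] `\` supp mu else set0.
  apply/eqP; rewrite eq_le measure_ge0 andbT.
  apply: (@le_trans _ _ (\sum_(n <oo) mu (F n))%E).
    apply: measure_sigma_subadditive => // g ng.
    have [l lg] := e_surj g; exists (pickle l) => //.
    by rewrite /F pickleK lg.
  rewrite eseries0// => n _ _; rewrite /F.
  case: (unpickle n) => [l|]; last exact: measure0.
  have [sl|nsl] := pselect (supp mu (e l)).
    have -> : [set e l] `\` supp mu = set0 by apply/seteqP; split=> // x [->].
    exact: measure0.
  have -> : [set e l] `\` supp mu = [set e l].
    by apply/seteqP; split=> [x []//|x ->].
  by apply/eqP; move: nsl => /negP; rewrite negbK.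
have mu_add : (mu (supp mu) + mu (~` supp mu) = 1)%E.
  by rewrite -(probability_setT mu) -measureU ?setUv// setICr.
have mu_fin : mu (supp mu) = (\sum_(g \in supp mu) mu [set g])%E.
  have sE : supp mu = \bigcup_(g in supp mu) [set g].
    by apply/seteqP; split=> [g sg|g [h sh ->//]]; exists g.
  rewrite [X in mu X]sE (measure_fin_bigcup mu)//.
  by move=> g h _ _ [_ [-> ->]].
apply: EFin_inj; rewrite -sumEFin; under eq_bigr do rewrite fineK//.
by rewrite -(fsbig_finite _ (fun g => mu [set g]))// -mu_fin -mu_add mu0 adde0.
Qed.

Theorem theorem1 (R : realType) (G : groupType) (X : ptopologicalType)
    (act : G -> X -> X) (mu : probability (discrete_group G) R)
    (G_fg : finitely_generated G)
    (mu_fs : finitely_supported mu)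
    (mu_nd : nondegenerate_measure mu)
    (X_lc : locally_compact [set: X])
    (X_haus : hausdorff_space X)
    (act_homeo : acts_by_homeomorphisms act)
    (act_coc : cocompact act) :
  exists lambda : {measure set (borel X) -> \bar R},
    [/\ radon lambda, nonzero_measure lambda & stationary act mu lambda].
Proof.
pose s := finmap.enum_fset (fset_set (supp mu)).
pose m g := fine (mu [set g]).
have supp_s g : (g \in s) = (g \in supp mu) by rewrite in_fset_set.
have mE g : mu [set g] = (m g)%:E by rewrite fineK//; exact: fin_num_measure.
have m_ge0 g : 0 <= m g by rewrite fine_ge0.
have m_gt0 g : g \in s -> 0 < m g.
  rewrite supp_s inE lt_neqAle m_ge0 andbT eq_sym => sg.
  by apply: contra_neq sg => mg; rewrite mE mg.
have s_gen : semigroup_generated [set` s] = [set: G] by rewrite fset_setK.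
have [L [L_lin L_ge0 L_walk [phi phiT Lphi]]] :=
  stationary_functional act_homeo act_coc X_lc X_haus m_gt0
    (sum_supp mu_fs mu_nd) s_gen.
have [lambda lambdaE] := riesz_measure X_lc X_haus L_lin.
exists lambda; split; first exact: (riesz_radon X_lc X_haus L_lin L_ge0).
  exists setT; first exact: measurableT.
  rewrite lambdaE riesz_outer_open; last exact: openT.
  (* The whole space has measure at least [L phi = 1]. *)
  have := riesz_open_ub L phiT; rewrite Lphi => T1.
  by rewrite gt_eqF// (lt_le_trans _ T1).
move=> E _; rewrite lambdaE.
(* The image of [E] under the inverse of [g] is its preimage under [g], and terms outside the
   support have weight 0. *)
have -> : (\esum_(g in [set: G]) (mu [set g] * translate act g lambda E) =
    \esum_(g in supp mu) ((m g)%:E * riesz_outer L (act g @^-1` E)))%E.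
  rewrite [RHS]esum_mkcond; apply: eq_esum => g _.
  rewrite mE /translate lambdaE; case: ifPn => [_|].
    congr (_ * riesz_outer L _)%E; apply/seteqP; split=> [_ [x Ex <-]|x Ex].
      by rewrite /= (homeo_actKV act_homeo).
    by exists (act g x) => //; exact: homeo_actK.
  rewrite notin_setE => /negP; rewrite negbK mE => /eqP ->.
  by rewrite mul0e.
rewrite esum_fset//; last first.
  by move=> g _; rewrite mule_ge0 ?lee_fin// riesz_outer_ge0.
rewrite (fsbig_finite _ _ mu_fs).
exact: (riesz_outer_stationary act_homeo m_ge0 m_gt0 L_lin L_ge0 L_walk).
Qed.
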